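(* Let $R$ be a $\ast$-ring. The following statements are equivalent: (1) $R$ is pro-$\ast$-reversible. (2) For all $a,b\in R$, $ab\in P(R)$ implies $ab^{\ast}\in P(R)$.
   Context: All rings are associative with unity. A $\ast$-ring is a ring $R$ equipped with an involution $\ast$, i.e. a map $\ast:R\to R$ with $(x+y)^{\ast}=x^{\ast}+y^{\ast}$, $(xy)^{\ast}=y^{\ast}x^{\ast}$ and $(x^{\ast})^{\ast}=x$ for all $x,y\in R$. $P(R)$ is the set of projections of $R$, i.e. elements $p$ with $p=p^{2}=p^{\ast}$. A $\ast$-ring $R$ is pro-$\ast$-reversible if for all $a,b\in R$, $ab\in P(R)$ implies $b^{\ast}a\in P(R)$. *)

(* Defs.v *)
From mathcomp Require Import all_boot all_order all_algebra.

Set Implicit Arguments.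
Unset Strict Implicit.
Unset Printing Implicit Defensive.

Import GRing.Theory.
Local Open Scope ring_scope.

(* A *-ring is a pair of a ring R and a map star : R -> R with is_star star.
   The ring may be the zero ring (pzRingType). *)
Definition is_star (R : pzRingType) (star : R -> R) : Prop :=
  [/\ {morph star : x y / x + y >-> x + y},
      {morph star : x y / x * y >-> y * x}
    & involutive star].

Definition is_projection (R : pzRingType) (star : R -> R) (p : R) : Prop :=
  p = p ^+ 2 /\ p = star p.

Definition pro_star_reversible (R : pzRingType) (star : R -> R) : Prop :=
  forall a b : R,
    is_projection star (a * b) -> is_projection star (star b * a).

(* Main.v *)
Require Import Defs.
From mathcomp Require Import all_boot all_order all_algebra.

Set Implicit Arguments.
Unset Strict Implicit.
Unset Printing Implicit Defensive.

Local Open Scope ring_scope.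

(** Each of the two conditions forces the set of pairs [(a, b)] whose product
    [a * b] is a projection to be symmetric in [a] and [b].  Once factors may be
    exchanged, the conclusions [star b * a] and [a * star b] are exchanges of
    each other, so the two conditions coincide.

    The symmetry rests on a projection being equal to its own star: a projection
    of the form [star b * star a] is the same element as [a * b].  Write
    [x -> y] when [x] being a projection makes [y] one.  Reversibility, used
    twice, gives [a * b -> star b * a -> star a * star b = b * a]; starring the
    right factor, used twice, gives
    [a * b -> a * star b = b * star a -> b * a]. *)

Lemma projection_star_mul (R : pzRingType) (star : R -> R) (a b : R) :
  is_star star -> is_projection star (a * b) -> star b * star a = a * b.
Proof. by move=> [_ starM _] [_ ab_sa]; rewrite -starM -ab_sa. Qed.

Lemma projection_mulC_of_reversible (R : pzRingType) (star : R -> R) :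
    is_star star -> pro_star_reversible star ->
  forall a b : R, is_projection star (a * b) -> is_projection star (b * a).
Proof.
move=> hstar rev a b /rev /rev proj_sab.
have [_ _ starK] := hstar.
have sab_ba := projection_star_mul hstar proj_sab.
by rewrite -sab_ba !starK in proj_sab.
Qed.

Lemma projection_mulC_of_mul_star (R : pzRingType) (star : R -> R) :
    is_star star ->
    (forall a b : R,
       is_projection star (a * b) -> is_projection star (a * star b)) ->
  forall a b : R, is_projection star (a * b) -> is_projection star (b * a).
Proof.
move=> hstar mul_star a b /mul_star proj_asb.
have [_ _ starK] := hstar.
have asb_bsa := projection_star_mul hstar proj_asb.
rewrite -asb_bsa starK in proj_asb.
by rewrite -[a]starK; apply: mul_star.
Qed.

Theorem corollary3p11 (R : pzRingType) (star : R -> R) (hstar : is_star star) :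
  pro_star_reversible star <->
  (forall a b : R,
     is_projection star (a * b) -> is_projection star (a * star b)).
Proof.
split=> [rev | mul_star] a b proj_ab.
- exact/(projection_mulC_of_reversible hstar rev)/rev.
- exact/(projection_mulC_of_mul_star hstar mul_star)/mul_star.
Qed.
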